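(* There exists some $r$ for which $GG_{n_1,n_2}(r)$ is infinite if and only if $\operatorname{lcm}(n_1, n_2) \notin \{2, 3, 4, 6\}$.
   Context: For positive integers $n_1,n_2$ and a real radius $r>0$, let $D_1$ and $D_2$ be the closed disks of radius $r$ in the Euclidean plane $\mathbb{R}^2$ centered at $(-1,0)$ and $(1,0)$ respectively. Let $a:\mathbb{R}^2\to\mathbb{R}^2$ be the bijection that rotates every point of $D_1$ about $(-1,0)$ by the angle $-2\pi/n_1$ (i.e. clockwise by $2\pi/n_1$) and fixes every point outside $D_1$. Let $b:\mathbb{R}^2\to\mathbb{R}^2$ be the bijection that rotates every point of $D_2$ about $(1,0)$ by the angle $-2\pi/n_2$ and fixes every point outside $D_2$. The two-disk compound symmetry group $GG_{n_1,n_2}(r)$ is the group of bijections of the plane generated by $a$ and $b$ under composition, with products read left to right: $(ab)(x)=b(a(x))$.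
   Formalization: The formal theorem assumes n_1, n_2 ≥ 2 rather than positive integers: if n_1 = 1 or n_2 = 1 one rotation is trivial and the group is finite cyclic for every r, so the claim fails e.g. for (1,5), where lcm = 5. *)

(* Defs.v *)
From mathcomp Require Import all_boot all_order all_algebra.
From mathcomp Require Import boolp classical_sets functions cardinality.
From mathcomp Require Import reals trigo.
From mathcomp Require Import ring.
Set Implicit Arguments.
Unset Strict Implicit.
Unset Printing Implicit Defensive.
Import Order.TTheory GRing.Theory Num.Theory.
Local Open Scope classical_set_scope.
Local Open Scope ring_scope.

(* The group generated by a set S of bijections of T. The constructor gen_inv
   adds the two-sided inverse of a member; composition is closed in both
   orders, so the left-to-right convention for products gives the same set. *)
Inductive generated (T : Type) (S : set (T -> T)) : set (T -> T) :=
| gen_one : generated S idfun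
| gen_mem f : S f -> generated S f
| gen_mul f g : generated S f -> generated S g -> generated S (g \o f)
| gen_inv f g : generated S f -> cancel f g -> cancel g f -> generated S g.

Section TwoDisks.
Variable R : realType.
Implicit Types (c p q : R * R) (r t : R).

(* The norm that the library puts on R * R is the sup norm, hence the explicit
   Euclidean distance. *)
Definition edist p q : R :=
  Num.sqrt ((p.1 - q.1) ^+ 2 + (p.2 - q.2) ^+ 2).

Definition disk c r : set (R * R) := [set p | edist p c <= r].

(* Counterclockwise rotation about c by the angle t. *)
Definition rotation c t p : R * R :=
  (c.1 + (cos t * (p.1 - c.1) - sin t * (p.2 - c.2)),
   c.2 + (sin t * (p.1 - c.1) + cos t * (p.2 - c.2))).

Definition disk_rotation c r t p : R * R :=
  if p \in disk c r then rotation c t p else p.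

Definition move_a (n1 : nat) r : R * R -> R * R :=
  disk_rotation (-1, 0) r (- (2 * pi / n1%:R)).

Definition move_b (n2 : nat) r : R * R -> R * R :=
  disk_rotation (1, 0) r (- (2 * pi / n2%:R)).

Definition GG (n1 n2 : nat) r : set (R * R -> R * R) :=
  generated [set move_a n1 r; move_b n2 r].

Lemma edist_rotation c t p : edist (rotation c t p) c = edist p c.
Proof.
rewrite /edist /rotation /=; congr Num.sqrt.
have -> : forall x y u v a b : R,
  (a + (x * u - y * v) - a) ^+ 2 + (b + (y * u + x * v) - b) ^+ 2 =
  (x ^+ 2 + y ^+ 2) * (u ^+ 2 + v ^+ 2) by move=> *; ring.
by rewrite cos2Dsin2 mul1r.
Qed.

Lemma rotationK c t : cancel (rotation c t) (rotation c (- t)).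
Proof.
move=> [x y]; rewrite /rotation cosN sinN /=.
have h := cos2Dsin2 t; congr pair.
- rewrite -[RHS](subrKC c.1) -[X in _ = _ + X]mul1r -h; ring.
- rewrite -[RHS](subrKC c.2) -[X in _ = _ + X]mul1r -h; ring.
Qed.

Lemma disk_rotationK c r t :
  cancel (disk_rotation c r t) (disk_rotation c r (- t)).
Proof.
move=> p; rewrite /disk_rotation.
case: (boolP (p \in disk c r)) => [pD|/negbTE -> //].
suff -> : rotation c t p \in disk c r by rewrite rotationK.
by move: pD; rewrite !in_setE /disk /= edist_rotation.
Qed.

Lemma disk_rotation_bij c r t : bijective (disk_rotation c r t).
Proof.
exists (disk_rotation c r (- t)); first exact: disk_rotationK.
by have := @disk_rotationK c r (- t); rewrite opprK.
Qed.

Lemma GG_bij n1 n2 r f : GG n1 n2 r f -> bijective f.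
Proof.
elim=> {f} [|f [->|->]|f g _ fb _ gb|f g _ _ fK gK].
- by exists idfun.
- exact: disk_rotation_bij.
- exact: disk_rotation_bij.
- exact: bij_comp.
- by exists f.
Qed.

End TwoDisks.

(* Main.v *)
Require Import Defs.
From mathcomp Require Import all_boot all_order all_algebra.
From mathcomp Require Import boolp classical_sets functions cardinality.
From mathcomp Require Import reals trigo.
From mathcomp Require Import algC algnum complex ring lra zify.
Set Implicit Arguments.
Unset Strict Implicit.
Unset Printing Implicit Defensive.
Import Order.TTheory GRing.Theory Num.Theory.
Local Open Scope classical_set_scope.
Local Open Scope ring_scope.

(** Identify the plane with the complex numbers and put n = lcm(n1, n2) and
    omega = exp(2 i pi / n). At each point, an element of the group acts by one
    of the isometries z |-> u z + w with u a power of omega.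

    If n is 5 or at least 7, the group is infinite for every large r. Well
    inside both disks, a disk rotation cannot be told from the full rotation,
    so every word in the full rotations is followed on a ball about 0 by the
    same word in the disk rotations, as soon as r exceeds the radius of the
    ball by a constant that depends on the word only (realized_comp,
    realized_inv). A commutator of the two rotations is a translation by some v
    != 0 (realized_translation), and conjugating it by a word of linear part
    omega and by its inverse gives the translations by omega v and v / omega,
    whose composite is the translation by alpha v with alpha = 2 cos(2 pi / n)
    (realized_scaled). Now alpha is an algebraic integer of ]0, 2[ other than
    1, hence irrational (two_cos_irrational). Adding v when the coordinate
    along v is at most 0, and subtracting alpha v otherwise, is a walk that
    stays in a fixed ball and never returns to a point, because 1 and alpha are
    independent over the rationals (walk_bound, walk_inj). Only two words are
    used, so a single r serves the whole walk, and 0 has an infinite orbit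
    (infinite_of_translations).

    If n is 2, 3, 4 or 6, then n divides m = 4 or m = 6, for which
    2 cos(2 pi / m) is an integer. The full rotations then lie in a group Gamma
    of isometries with translation parts in the lattice spanned by 1 and
    zeta = exp(2 i pi / m), and only finitely many members of Gamma have a
    bounded translation part (lattice_isometries_discrete). Call two points
    similar when every member of Gamma sends them to the same side of each
    disk. On a similarity class, every element of the group is a single member
    of Gamma (GG_piecewise). Inside the two disks, which are bounded and stable
    under the group, only finitely many members of Gamma matter, both to
    separate the classes and as values; outside, the group acts trivially.
    Hence there are finitely many elements (finite_GG). *)

(** * The complex plane and roots of unity *)

Section ComplexPlane.
Local Open Scope complex_scope.
Variable R : realType.
Implicit Types (p c : R * R) (z u w v : R[i]) (r t : R).

Definition toC p : R[i] := p.1 +i* p.2.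
Definition ofC z : R * R := let: x +i* y := z in (x, y).

Lemma toCK : cancel toC ofC. Proof. by case. Qed.
Lemma ofCK : cancel ofC toC. Proof. by case. Qed.

Definition cis t : R[i] := cos t +i* sin t.

Lemma cisD s t : cis (s + t) = cis s * cis t.
Proof. by rewrite /cis cosD sinD; simpc; rewrite [sin s * _ + _]addrC. Qed.

Lemma cis0 : cis 0 = 1. Proof. by rewrite /cis cos0 sin0. Qed.

Lemma cisX t k : cis t ^+ k = cis (t *+ k).
Proof. by elim: k => [|k IH]; rewrite ?expr0 ?cis0 // exprS IH mulrS cisD. Qed.

Lemma cis_norm t : `|cis t| = 1.
Proof. by rewrite normc_def /= cos2Dsin2 sqrtr1. Qed.

Lemma cisN t : cis (- t) = (cis t)^-1.
Proof.
apply: (mulIf (x := cis t)); first by rewrite -normr_eq0 cis_norm oner_eq0.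
by rewrite -cisD addNr cis0 mulVf // -normr_eq0 cis_norm oner_eq0.
Qed.

Lemma cis_pi : cis pi = -1.
Proof. by apply/eqP; rewrite eq_complex /= cospi sinpi oppr0 !eqxx. Qed.

Lemma toC_rotation c t p :
  toC (rotation c t p) = cis t * (toC p - toC c) + toC c.
Proof.
by rewrite /toC /rotation /cis /=; simpc; congr (_ +i* _); ring.
Qed.

Lemma in_diskE c r p : (p \in disk c r) = (`|toC p - toC c| <= r%:C).
Proof.
rewrite normc_def /toC /=; simpc.
by apply/idP/idP; rewrite in_setE.
Qed.

Definition root1 n : R[i] := cis (2 * pi / n%:R).

Lemma root1X n : (0 < n)%N -> root1 n ^+ n = 1.
Proof.
move=> n0; rewrite cisX -[_ *+ n]mulr_natr divfK ?pnatr_eq0 -?lt0n //.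
by rewrite mulrC mulr_natr mulr2n cisD cis_pi mulrNN mulr1.
Qed.

Lemma root1_neq0 n : root1 n != 0.
Proof. by rewrite -normr_eq0 cis_norm oner_eq0. Qed.

Lemma root1_dvd m n : (0 < n)%N -> (m %| n)%N ->
  root1 m = root1 n ^+ (n %/ m)%N.
Proof.
move=> n0 mn; rewrite cisX; congr cis.
rewrite -[RHS]mulr_natr -{1}(divnK mn) natrM.
have m0 : (0 < m)%N := dvdn_gt0 n0 mn.
have d0 : (0 < (n %/ m)%N)%N by rewrite divn_gt0 // dvdn_leq.
by field; rewrite !pnatr_eq0 -!lt0n m0 d0.
Qed.

(** With t = pi / n, cos(2 t) = 1 - 2 sin(t)^2, and sin does not vanish on
    ]0, pi[. *)
Lemma root1_neq1 n : (1 < n)%N -> root1 n != 1.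
Proof.
move=> n1; apply/eqP => -[] /(congr1 (fun x : R => x)) h _; move: h.
have n0 : 0 < n%:R :> R by rewrite ltr0n; lia.
have -> : 2 * pi / n%:R = (pi / n%:R) *+ 2 :> R by rewrite -mulr_natr; ring.
rewrite cos_mulr2n cos2sin2 => h.
have : 0 < sin (pi / n%:R) :> R.
  apply: sin_gt0_pi; rewrite divr_gt0 ?pi_gt0 //= ltr_pdivrMr //.
  by rewrite ltr_pMr ?pi_gt0 // ltr1n.
suff -> : sin (pi / n%:R) = 0 :> R by rewrite ltxx.
by apply/eqP; rewrite -sqrf_eq0; apply/eqP; lra.
Qed.

Lemma root1D_inv n :
  root1 n + (root1 n)^-1 = (2 * cos (2 * pi / n%:R) : R)%:C.
Proof.
by rewrite /root1 -cisN /cis cosN sinN; simpc; congr (_ +i* _); ring.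
Qed.

End ComplexPlane.

(** * Isometries realized deep inside both disks *)

(** A common divisor d of the two cofactors would make lcm(m, n) / d a smaller
    common multiple. This is what lets a Bezout relation express exp(2 i pi / n)
    through the two given rotations. *)
Lemma coprime_lcm_cofactors m n : (0 < m)%N -> (0 < n)%N ->
  coprime (lcmn m n %/ m) (lcmn m n %/ n).
Proof.
move=> m0 n0; set l := lcmn m n.
have l0 : (0 < l)%N by rewrite lcmn_gt0 m0.
have dm : (m %| l)%N := dvdn_lcml _ _.
have dn : (n %| l)%N := dvdn_lcmr _ _.
have [d_m d_n] := (dvdn_gcdl (l %/ m) (l %/ n), dvdn_gcdr (l %/ m) (l %/ n)).
rewrite /coprime; set d := gcdn _ _ in d_m d_n *.
have [/dvdnP[j jE] /dvdnP[k kE]] := (d_m, d_n).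
have jm : (j * m * d = l)%N by rewrite -(divnK dm) jE mulnAC.
have kn : (k * n * d = l)%N by rewrite -(divnK dn) kE mulnAC.
have d0 : (0 < d)%N by move: l0; rewrite -jm muln_gt0 => /andP[].
have : (l %| j * m)%N.
  rewrite dvdn_lcm dvdn_mull //=.
  suff -> : (j * m = k * n)%N by rewrite dvdn_mull.
  by apply/eqP; rewrite -(eqn_pmul2r d0) jm kn.
have /andP[a0 _] : (0 < j * m)%N && (0 < d)%N by rewrite -muln_gt0 jm.
by move=> /(dvdn_leq a0); rewrite -jm -{2}[(j * m)%N]muln1 leq_pmul2l //; lia.
Qed.

Section Local.
Local Open Scope complex_scope.
Variables (R : realType) (n1 n2 : nat).
Implicit Types (p c : R * R) (u w v x z : R[i]) (r t : R).

(** The margin K bounds how far a word can move a point on the way, so it does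
    not depend on r: this uniformity makes the notion stable under composition,
    and lets one r serve finitely many isometries. *)
Definition realized u w : Prop :=
  `|u| = 1 /\ exists2 K : R[i], 0 <= K & forall r, exists2 f, GG n1 n2 r f &
    forall z, `|z| + K <= r%:C -> toC (f (ofC z)) = u * z + w.

(** A point with margin K + |w| + L keeps the margin L after the first isometry,
    since |u z + w| <= |z| + |w|. *)
Lemma realized_comp u w v x :
  realized u w -> realized v x -> realized (v * u) (v * w + x).
Proof.
move=> [u1 [K K0 Kf]] [v1 [L L0 Lf]]; split.
  by rewrite normrM u1 v1 mulr1.
exists (K + `|w| + L) => [|r]; first by rewrite !addr_ge0.
have [f Gf fE] := Kf r; have [g Gg gE] := Lf r.
exists (g \o f); first exact: gen_mul.
move=> z zr /=.
have fz : toC (f (ofC z)) = u * z + w.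
  by apply: fE; apply: le_trans zr; rewrite lerD2l -addrA lerDl addr_ge0.
rewrite -[f _]toCK fz gE; first ring.
apply: le_trans zr; rewrite !addrA lerD2r.
by rewrite (le_trans (ler_normD _ _)) // normrM u1 mul1r lerD2r lerDl.
Qed.

Lemma realized_inv u w : realized u w -> realized u^-1 (- (u^-1 * w)).
Proof.
move=> [u1 [K K0 Kf]]; have u0 : u != 0 by rewrite -normr_eq0 u1 oner_eq0.
split; first by rewrite normfV u1 invr1.
exists (K + `|w|) => [|r]; first by rewrite addr_ge0.
have [f Gf fE] := Kf r; have [g fK gK] := GG_bij Gf.
exists g => [|z zr]; first exact: gen_inv Gf fK gK.
have fz : toC (f (ofC (u^-1 * (z - w)))) = z.
  rewrite fE ?mulVKf ?subrK //; apply: le_trans zr.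
  rewrite normrM normfV u1 invr1 mul1r [K + _]addrC addrA lerD2r.
  by rewrite (le_trans (ler_normB _ _)).
by rewrite -{1}fz toCK fK ofCK mulrBr.
Qed.

(** A center at distance 1 from 0 lets the margin be 1: |z| + 1 <= r puts z in
    the disk. *)
Lemma realized_disk_rotation c t : `|toC c| = 1 ->
    (forall r, GG n1 n2 r (disk_rotation c r t)) ->
  realized (cis t) (toC c - cis t * toC c).
Proof.
move=> c1 Gc; split; first exact: cis_norm.
exists 1 => // r; exists (disk_rotation c r t) => // z zr.
rewrite /disk_rotation in_diskE ofCK ifT; last first.
  by rewrite (le_trans (ler_normB _ _)) // c1.
by rewrite toC_rotation ofCK; ring.
Qed.

Lemma toC_1 : toC (1, 0) = 1 :> R[i]. Proof. by []. Qed.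
Lemma toC_N1 : toC (-1, 0) = -1 :> R[i].
Proof. by apply/eqP; rewrite eq_complex /= oppr0 !eqxx. Qed.

Lemma realized_a : realized (root1 R n1)^-1 ((root1 R n1)^-1 - 1).
Proof.
have := @realized_disk_rotation (-1, 0) (- (2 * pi / n1%:R)).
rewrite toC_N1 normrN1 cisN mulrN1 opprK addrC; apply => // r.
by apply: gen_mem; left.
Qed.

Lemma realized_b : realized (root1 R n2)^-1 (1 - (root1 R n2)^-1).
Proof.
have := @realized_disk_rotation (1, 0) (- (2 * pi / n2%:R)).
rewrite toC_1 normr1 cisN mulr1; apply => // r.
by apply: gen_mem; right.
Qed.

Lemma realized1 : realized 1 0.
Proof.
have := realized_comp realized_a (realized_inv realized_a).
by rewrite mulVf ?invr_eq0 ?root1_neq0 // addrN.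
Qed.

Lemma realizedX u w k : realized u w -> exists x, realized (u ^+ k) x.
Proof.
move=> uw; elim: k => [|k [x ux]]; first by exists 0; apply: realized1.
by exists (u * x + w); rewrite exprS; apply: realized_comp.
Qed.

Hypotheses (n1_gt1 : (1 < n1)%N) (n2_gt1 : (1 < n2)%N).
Let n := lcmn n1 n2.
Let omega := root1 R n.
Let n_gt0 : (0 < n)%N. Proof. rewrite lcmn_gt0; lia. Qed.

(** The commutator of two rotations has trivial linear part; for centers 1 and
    -1 and linear parts t and s, its translation is 2 (1 - 1/s) (1/t - 1). *)
Lemma realized_translation : exists2 v, v != 0 & realized 1 v.
Proof.
pose s := (root1 R n1)^-1; pose t := (root1 R n2)^-1.
have s0 : s != 0 by rewrite invr_eq0 root1_neq0.
have t0 : t != 0 by rewrite invr_eq0 root1_neq0.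
have h1 := realized_comp realized_b realized_a.
have h2 := realized_inv (realized_comp realized_a realized_b).
have := realized_comp h1 h2; rewrite -/s -/t => h.
exists (2 * (1 - s^-1) * (t^-1 - 1)).
  have s1 : s^-1 != 1 by rewrite invrK root1_neq1.
  have t1 : t^-1 != 1 by rewrite invrK root1_neq1.
  by rewrite !mulf_neq0 ?pnatr_eq0 // subr_eq0 // eq_sym.
by congr realized: h; field; rewrite s0 t0.
Qed.

(** Bezout on the cofactors m1 = n / n1 and m2 = n / n2: if i m1 = j m2 + 1 then
    omega = omega^(i m1) omega^(- j m2), a product of powers of the linear parts
    of the generators. *)
Lemma realized_root : exists x, realized omega x.
Proof.
have [n10 n20] : (0 < n1)%N /\ (0 < n2)%N by lia.
have := coprime_lcm_cofactors n10 n20.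
have := root1_dvd R n_gt0 (dvdn_lcmr n1 n2).
have := root1_dvd R n_gt0 (dvdn_lcml n1 n2).
have : (0 < lcmn n1 n2 %/ n1)%N.
  by rewrite divn_gt0 // (dvdn_leq n_gt0) // dvdn_lcml.
rewrite -/omega; move: (_ %/ n1)%N (_ %/ n2)%N => m1 m2 m10 e1 e2 /eqP co.
case: (egcdnP m2 m10) => i j e _.
have [x ax] := realizedX i (realized_inv realized_a).
have [y bY] := realizedX j realized_b.
exists ((root1 R n2)^-1 ^+ j * x + y).
have := realized_comp ax bY; congr realized.
rewrite invrK e1 e2 exprVn -!exprM [(m1 * i)%N]mulnC [(m2 * j)%N]mulnC e co.
by rewrite exprD mulKf // expf_neq0 ?root1_neq0.
Qed.

Lemma realized_conj u w v : realized u w -> realized 1 v -> realized 1 (u * v).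
Proof.
move=> uw vt; have u0 : u != 0 by rewrite -normr_eq0 uw.1 oner_eq0.
have := realized_comp (realized_comp (realized_inv uw) vt) uw.
by congr realized; field.
Qed.

(** The translations by omega v and v / omega compose to that by
    (omega + 1 / omega) v; the inverse is taken to step back along v. *)
Lemma realized_scaled v : realized 1 v ->
  realized 1 (- ((2 * cos (2 * pi / n%:R))%:C * v)).
Proof.
move=> vt; have [x ox] := realized_root.
have h1 := realized_conj ox vt; have h2 := realized_conj (realized_inv ox) vt.
have := realized_inv (realized_comp h1 h2).
by rewrite !mul1r invr1 mul1r -mulrDl root1D_inv.
Qed.
End Local.

(** * Irrationality of 2 cos(2 pi / n) *)

(** The ring of integers is integrally closed, read off algebraic integers in
    algC. *)
Lemma rat_integral_int (x : rat) :
  integralOver (intr : int -> rat) x -> x \is a Num.int.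
Proof.
move=> [p pm px]; have : ratr x \in Aint.
  apply: (@root_monic_Aint (map_poly intr p)).
  - have -> : map_poly intr p = map_poly ratr (map_poly intr p) :> {poly algC}.
      by rewrite -map_poly_comp; apply: eq_map_poly => a /=; rewrite ratr_int.
    by rewrite fmorph_root.
  - by rewrite monic_map.
  - by apply/polyOverP => i; rewrite coef_map /= intr_int.
move=> /(Cint_rat_Aint (Crat_rat x)) /intrP[a]; rewrite -ratr_int.
by move=> /fmorph_inj ->; rewrite intr_int.
Qed.

Section Cosines.
Local Open Scope complex_scope.
Variable R : realType.

(** It is the sum of the roots of unity omega and 1 / omega. *)
Lemma two_cos_integral n : (0 < n)%N ->
  integralOver (intr : int -> R[i]) (2 * cos (2 * pi / n%:R) : R)%:C.
Proof.
move=> n0; have int1 (z : R[i]) :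
    z ^+ n = 1 -> integralOver (intr : int -> R[i]) z.
  move=> z1; exists ('X^n - 1); first by rewrite monicXnsubC.
  rewrite rmorphB rmorph1 /= map_polyXn.
  by rewrite /root !hornerE z1 subrr.
rewrite -root1D_inv.
by apply: integral_add; apply: int1; rewrite ?exprVn root1X ?invr1.
Qed.

Lemma two_cos_rat_int n (x : rat) : (0 < n)%N ->
  2 * cos (2 * pi / n%:R) = ratr x :> R -> x \is a Num.int.
Proof.
move=> n0 cx; have [p pm] := two_cos_integral n0; rewrite cx => px.
apply: rat_integral_int; exists p => //.
pose f : {rmorphism rat -> R[i]} := real_complex R \o ratr.
have e : map_poly intr p = map_poly f (map_poly intr p) :> {poly R[i]}.
  by rewrite -map_poly_comp; apply: eq_map_poly => a; rewrite [RHS]rmorph_int.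
by move: px; rewrite e (fmorph_root f).
Qed.

(** The triple angle formula turns cos(pi) = -1 into (2 c - 1)^2 (c + 1) = 0. *)
Lemma cos_pi3 : cos (pi / 3) = 1 / 2 :> R.
Proof.
have pi0 := pi_gt0 R.
set c := cos (pi / 3).
have c0 : 0 < c by apply: cos_gt0_pihalf; apply/andP; split; lra.
have : cos (pi / 3 + (pi / 3) *+ 2) = -1 :> R.
  by rewrite -cospi; congr cos; rewrite -mulr_natr; field.
rewrite cosD cos_mulr2n sin_mulr2n -/c => h.
have s2 : sin (pi / 3) ^+ 2 = 1 - c ^+ 2 :> R by rewrite sin2cos2.
have e : (2 * c - 1) ^+ 2 * (c + 1) = 0.
  have -> : (2 * c - 1) ^+ 2 * (c + 1) =
    c * (c ^+ 2 *+ 2 - 1) - 2 * c * (1 - c ^+ 2) + 1 by ring.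
  rewrite -s2 [X in X + 1](_ : _ = -1) ?addNr // -[RHS]h; ring.
move/eqP: e; rewrite mulf_eq0 sqrf_eq0 => /orP[] /eqP; lra.
Qed.

(** A rational value would be an integer in ]0, 2[, that is 1, and then
    2 pi / n = pi / 3 by injectivity of cos. *)
Lemma two_cos_irrational n : n = 5%N \/ (7 <= n)%N ->
  0 < 2 * cos (2 * pi / n%:R) :> R /\
  forall x : rat, 2 * cos (2 * pi / n%:R) != ratr x :> R.
Proof.
move=> hn; have n5 : (5 <= n)%N by lia.
have pi0 := pi_gt0 R.
have n0 : 0 < n%:R :> R by rewrite ltr0n; lia.
have nR : 5 <= n%:R :> R by rewrite ler_nat.
set t : R := 2 * pi / n%:R.
have t0 : 0 < t by rewrite divr_gt0 // mulr_gt0.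
have t5 : t <= 2 * pi / 5 by rewrite ler_pM2l ?mulr_gt0 // lef_pV2 ?posrE.
have c0 : 0 < cos t by apply: cos_gt0_pihalf; apply/andP; split; lra.
split; first by rewrite mulr_gt0.
move=> x; apply/eqP => cx.
have c1 : cos t < 1 by rewrite -cos0 ltr_cos ?in_itv /=; lra.
have t3 : t != pi / 3.
  apply/eqP => e; have : 6%:R = n%:R :> R.
    have : t * n%:R = 2 * pi by rewrite /t divfK // gt_eqF.
    by rewrite e => e6; apply: (mulfI (lt0r_neq0 pi0)); lra.
  by move/eqP; rewrite eqr_nat => /eqP; lia.
have [a ax] := intrP (two_cos_rat_int (n := n) ltac:(lia) cx).
move: cx; rewrite ax ratr_int => ca.
have a0 : 0 < a by rewrite -(ltr0z R) -ca mulr_gt0.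
have a2 : a < 2 by rewrite -(ltr_int R) -ca; lra.
have a1 : a = 1 by lia.
move/eqP: t3; apply; apply: cos_inj; rewrite ?in_itv /=; try lra.
by rewrite cos_pi3; move: ca; rewrite a1; lra.
Qed.
End Cosines.

(** * A bounded walk that never repeats *)

Section Walk.
Variables (R : realType) (a : R).

(** A state (i, j) counts the steps made to the right, of length 1, and to the
    left, of length a. *)
Definition pos (s : nat * nat) : R := s.1%:R - s.2%:R * a.

Definition step (s : nat * nat) : nat * nat :=
  if pos s <= 0 then (s.1.+1, s.2) else (s.1, s.2.+1).

Definition walk k := iter k step (0, 0)%N.

Lemma pos_step s : pos (step s) = pos s + (if pos s <= 0 then 1 else - a).
Proof. by rewrite /step; case: ifP => _; rewrite /pos /= -natr1; ring. Qed.

Lemma walk_bound k : 0 < a -> `|pos (walk k)| <= 1 + a.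
Proof.
move=> a0; have : - a <= pos (walk k) <= 1.
  elim: k => [|k IH]; first by rewrite /pos /= mul0r subrr oppr_le0 ltW ?ler01.
  rewrite /walk iterS -/(walk k) pos_step; move: IH => /andP[].
  by case: (lerP (pos (walk k)) 0) => *; apply/andP; split; lra.
by move=> /andP[l u]; rewrite ler_norml; apply/andP; split; lra.
Qed.

Lemma walk_sum k : ((walk k).1 + (walk k).2 = k)%N.
Proof.
elim: k => // k IH; rewrite /walk iterS -/(walk k) /step.
by case: ifP => _ /=; lia.
Qed.

(** A position determines its state when a is irrational, and the state
    determines the time as the sum of its components. *)
Lemma walk_inj : (forall x : rat, a != ratr x) -> injective (pos \o walk).
Proof.
move=> a_irr j k /= e.
have [ej|nj] := eqVneq (walk j).2 (walk k).2.
  rewrite -(walk_sum j) -(walk_sum k) ej; congr (_ + _)%N.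
  by move: e; rewrite /pos ej => /addIr /eqP; rewrite eqr_nat => /eqP.
pose p : rat := (walk j).1%:R - (walk k).1%:R.
pose q : rat := (walk j).2%:R - (walk k).2%:R.
case/negP: (a_irr (p / q)); apply/eqP.
rewrite fmorph_div /= !rmorphB /= !ratr_nat.
have qR : (walk j).2%:R - (walk k).2%:R != 0 :> R by rewrite subr_eq0 eqr_nat.
apply: (mulIf qR); rewrite divfK //.
by move: e; rewrite /pos; lra.
Qed.
End Walk.

Section Orbit.
Local Open Scope complex_scope.
Variables (R : realType) (n1 n2 : nat).
Implicit Types v : R[i].

(** The orbit of 0 contains pos(walk k) v for every k: one of the two
    translations extends an element reaching the k-th point to one reaching the
    next, and the bound on the walk keeps all these points within the margin. *)
Lemma infinite_of_translations v (a : R) : v != 0 -> 0 < a ->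
    (forall x : rat, a != ratr x) ->
    realized n1 n2 1 v -> realized n1 n2 1 (- (a%:C * v)) ->
  exists r : R, 0 < r /\ infinite_set (GG n1 n2 r).
Proof.
move=> v0 a0 a_irr [_ [K K0 Kf]] [_ [L L0 Lf]].
pose B : R[i] := (1 + a)%:C * `|v| + K + L.
have a1 : 0 <= (1 + a)%:C by rewrite ler0c; lra.
have B0 : 0 <= B by rewrite !addr_ge0 // mulr_ge0.
have [b BE] : exists b : R, B = b%:C by apply/complex_realP; exact: ger0_real.
exists (b + 1).
have b0 : 0 <= b by rewrite -ler0c -BE.
split; first by lra.
have rB : B <= (b + 1)%:C by rewrite BE lecR lerDl.
have [f Gf fE] := Kf (b + 1); have [g Gg gE] := Lf (b + 1).
have inside k : `|(pos a (walk a k))%:C * v| <= (1 + a)%:C * `|v|.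
  rewrite normrM ler_wpM2r //.
  by rewrite normc_def /= expr0n addr0 sqrtr_sqr lecR walk_bound.
have /choice[F FP] : forall k, exists h, GG n1 n2 (b + 1) h /\
    toC (h (ofC 0)) = (pos a (walk a k))%:C * v.
  elim=> [|k [h [Gh hE]]].
    exists idfun; split; first exact: gen_one.
    by rewrite ofCK /pos /= mul0r subrr mul0r.
  rewrite /walk iterS -/(walk a k) pos_step.
  case: ifP => _; [exists (f \o h)|exists (g \o h)]; split;
    try exact: gen_mul; rewrite /= -[h _]toCK hE.
  - rewrite fE; first by rewrite [in RHS]rmorphD rmorph1; ring.
    by apply: le_trans rB; rewrite /B -[leRHS]addrA lerD ?inside // lerDl.
  - rewrite gE; first by rewrite [in RHS]rmorphD rmorphN; ring.
    apply: le_trans rB; rewrite /B lerD2r; apply: le_trans (inside k) _.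
    by rewrite lerDl.
move=> /(sub_finite_set (A := range F)) fin.
have /fin : range F `<=` GG n1 n2 (b + 1) by move=> _ [k _ <-]; case: (FP k).
have Finj : injective F.
  move=> j k e; apply: (walk_inj a_irr); apply: complexI.
  by apply: (mulIf v0); rewrite /= -(FP j).2 -(FP k).2 e.
move=> /(finite_preimage (f := F)) h; apply: infinite_nat.
apply: (sub_finite_set _ (h _)) => [k _|j k _ _]; first by exists k.
exact: Finj.
Qed.

Lemma infinite_GG : (1 < n1)%N -> (1 < n2)%N ->
    lcmn n1 n2 = 5%N \/ (7 <= lcmn n1 n2)%N ->
  exists r : R, 0 < r /\ infinite_set (GG n1 n2 r).
Proof.
move=> n1_gt1 n2_gt1 /(two_cos_irrational R)[c0 c_irr].
have [v v0 vt] := realized_translation R n1_gt1 n2_gt1.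
apply: (infinite_of_translations v0 c0 c_irr vt).
exact: (realized_scaled n1_gt1 n2_gt1 vt).
Qed.
End Orbit.

(** * Finiteness for a discrete group of isometries *)

Section Discrete.
Local Open Scope complex_scope.
Variables (R : realType) (n1 n2 : nat) (r : R).
Hypothesis r0 : 0 < r.
Implicit Types (p x y : R * R) (k l : R[i] * R[i]) (f g : R * R -> R * R).

Definition act k p : R * R := ofC (k.1 * toC p + k.2).

Let D1 : set (R * R) := disk (-1, 0) r.
Let D2 : set (R * R) := disk (1, 0) r.
Let D := D1 `|` D2.

Lemma disk_rotation_disk c t p :
  p \in disk c r -> disk_rotation c r t p \in disk c r.
Proof.
move=> pD; rewrite /disk_rotation pD; move: pD.
by rewrite !in_setE /disk /= edist_rotation.
Qed.

Lemma disk_rotation_out c t p : p \notin disk c r -> disk_rotation c r t p = p.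
Proof. by rewrite /disk_rotation => /negbTE ->. Qed.

(** Each generator stabilizes its own disk and fixes all other points, so it
    stabilizes the union. *)
Lemma GG_support f : GG n1 n2 r f ->
  (forall x, ~ D x -> f x = x) /\ (forall x, D x -> D (f x)).
Proof.
elim=> {f} [|f|f g _ [f1 f2] _ [g1 g2]|f g _ [f1 f2] fK gK].
- by [].
- suff h c t : disk c r `<=` D ->
      (forall x, ~ D x -> disk_rotation c r t x = x) /\
      (forall x, D x -> D (disk_rotation c r t x)).
    by case=> ->; apply: h; [exact: subsetUl|exact: subsetUr].
  move=> cD; split=> x xD.
    by apply: disk_rotation_out; apply/negP; rewrite in_setE => /cD.
  have [xc|xc] := boolP (x \in disk c r).
    by apply: cD; rewrite -in_setE; exact: disk_rotation_disk.
  by rewrite disk_rotation_out.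
- split=> x xD /=; last by apply: g2; apply: f2.
  by rewrite f1 // g1.
- split=> x xD; first by rewrite -{1}(f1 x xD) fK.
  by apply: contrapT => gxD; apply: (gxD); rewrite -(f1 _ gxD) gK.
Qed.

Lemma D_bounded p : D p -> `|toC p| <= (r + 1)%:C.
Proof.
have h c : `|toC c| = 1 -> disk c r p -> `|toC p| <= (r + 1)%:C.
  move=> c1; rewrite -in_setE in_diskE => pc.
  rewrite -[toC p](subrK (toC c)) (le_trans (ler_normD _ _)) // c1.
  by rewrite rmorphD rmorph1 lerD2r.
case; apply: h; first by rewrite toC_N1 normrN1.
by rewrite toC_1 normr1.
Qed.

Variable Gamma : set (R[i] * R[i]).
Hypothesis Gamma1 : Gamma (1, 0).
Hypothesis GammaM : forall k l, Gamma k -> Gamma l ->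
  Gamma (k.1 * l.1, k.1 * l.2 + k.2).
Hypothesis GammaV : forall k, Gamma k -> Gamma (k.1^-1, - (k.1^-1 * k.2)).
Hypothesis Gamma_norm : forall k, Gamma k -> `|k.1| = 1.
Hypothesis Gamma_a : Gamma ((root1 R n1)^-1, (root1 R n1)^-1 - 1).
Hypothesis Gamma_b : Gamma ((root1 R n2)^-1, 1 - (root1 R n2)^-1).
Hypothesis Gamma_discrete : forall B : R,
  finite_set [set k | Gamma k /\ `|k.2| <= B%:C].

(** Points with the same itinerary: since Gamma is a group, whatever sequence of
    moves is applied, similar points are rotated at the same times. *)
Definition sim x y := forall k, Gamma k ->
  (act k x \in D1) = (act k y \in D1) /\ (act k x \in D2) = (act k y \in D2).

Lemma act1 x : act (1, 0) x = x.
Proof. by rewrite /act mul1r addr0 toCK. Qed.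

Lemma actM k l x : act (k.1 * l.1, k.1 * l.2 + k.2) x = act k (act l x).
Proof. by rewrite /act ofCK /=; congr ofC; ring. Qed.

Lemma actVK k x : Gamma k -> act k (act (k.1^-1, - (k.1^-1 * k.2)) x) = x.
Proof.
move=> /Gamma_norm k1; have k0 : k.1 != 0 by rewrite -normr_eq0 k1 oner_eq0.
by rewrite /act ofCK /= mulrDr mulVKf // mulrN mulVKf // subrK toCK.
Qed.

Lemma actKV k x : Gamma k -> act (k.1^-1, - (k.1^-1 * k.2)) (act k x) = x.
Proof.
move=> /Gamma_norm k1; have k0 : k.1 != 0 by rewrite -normr_eq0 k1 oner_eq0.
by rewrite /act ofCK /= mulrDr mulKf // addrK toCK.
Qed.

Lemma sim_act k x y : Gamma k -> sim x y -> sim (act k x) (act k y).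
Proof. by move=> Gk xy l Gl; rewrite -!actM; apply: xy; apply: GammaM. Qed.

Lemma act_rotation c t x :
  act (cis t, toC c - cis t * toC c) x = rotation c t x.
Proof. by apply: (can_inj (@toCK R)); rewrite ofCK toC_rotation /=; ring. Qed.

(** The generators look only at the disk containing a point, which similarity
    records; composition works because Gamma preserves similarity, and for an
    inverse one starts from the element that f uses at the preimage. *)
Lemma GG_piecewise f : GG n1 n2 r f ->
  forall x, exists2 k, Gamma k & forall y, sim x y -> f y = act k y.
Proof.
elim=> {f} [|f|f g _ IHf _ IHg|f g _ IHf fK gK].
- by move=> x; exists (1, 0) => // y _; rewrite act1.
- have h c t x : Gamma (cis t, toC c - cis t * toC c) ->
      (forall y, sim x y -> (x \in disk c r) = (y \in disk c r)) ->
      exists2 k, Gamma k &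
        forall y, sim x y -> disk_rotation c r t y = act k y.
    move=> Gct xE; have [xc|xc] := boolP (x \in disk c r).
      exists (cis t, toC c - cis t * toC c) => // y /xE; rewrite xc => yc.
      by rewrite /disk_rotation -yc act_rotation.
    exists (1, 0) => // y /xE; rewrite (negbTE xc) => yc.
    by rewrite /disk_rotation -yc act1.
  case=> -> x; apply: h.
  + by rewrite toC_N1 cisN mulrN1 opprK addrC.
  + by move=> y /(_ _ Gamma1)[]; rewrite !act1.
  + by rewrite toC_1 cisN mulr1.
  + by move=> y /(_ _ Gamma1)[_]; rewrite !act1.
- move=> x; have [k Gk fE] := IHf x; have [l Gl gE] := IHg (act k x).
  exists (l.1 * k.1, l.1 * k.2 + l.2); first exact: GammaM.
  by move=> y xy; rewrite /= fE // gE ?actM //; apply: sim_act.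
- move=> x; have [k Gk fE] := IHf (g x); have Gk' := GammaV Gk.
  exists (k.1^-1, - (k.1^-1 * k.2)) => // y xy.
  set k' := (_, _) in Gk' *.
  have gx : act k' x = g x by rewrite -{1}(gK x) fE ?actKV.
  by rewrite -[LHS]fK gK -{1}(actVK y Gk) -/k' -fE ?fK // -gx; apply: sim_act.
Qed.

(** An element of Gamma sending a point of the disks into the disks has a
    translation part of norm at most 2 (r + 1). The finitely many such elements,
    listed in s, thus decide similarity, and an element of the group is encoded
    by the map sending each of the finitely many types to an entry of s. *)
Theorem finite_GG : finite_set (GG n1 n2 r).
Proof.
have /finite_seqP[s sE] := Gamma_discrete (2 * (r + 1)).
have rr : (2 * (r + 1))%:C = (r + 1)%:C + (r + 1)%:C.
  by rewrite -rmorphD -mulr2n mulr_natl.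
have r1 : 0 <= (r + 1)%:C by rewrite ler0c addr_ge0 // ltW.
have in_s k : (k \in s) <-> Gamma k /\ `|k.2| <= (2 * (r + 1))%:C.
  by have := congr1 (fun A => A k) sE => /= <-.
pose type_of x : {ffun seq_sub s -> bool * bool} :=
  [ffun k => (act (val k) x \in D1, act (val k) x \in D2)].
have stay_in_s k x : Gamma k -> D x -> D (act k x) -> k \in s.
  move=> Gk xD kxD; apply/in_s; split => //; rewrite rr.
  have -> : k.2 = toC (act k x) - k.1 * toC x by rewrite ofCK addrC addKr.
  rewrite (le_trans (ler_normB _ _)) // normrM Gamma_norm // mul1r.
  by rewrite lerD // D_bounded.
have type_sim x y : D x -> D y -> type_of x = type_of y -> sim x y.
  move=> xD yD e k Gk; have [ks|ks] := boolP (k \in s).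
    have := congr1 (fun F : {ffun _ -> _} => F (SeqSub ks)) e.
    by rewrite !ffunE => -[-> ->].
  have out z : D z -> act k z \notin D1 /\ act k z \notin D2.
    move=> zD; split; apply/negP; rewrite in_setE => h; case/negP: ks;
      apply: (stay_in_s _ z) => //; by [left|right].
  have [xD1 xD2] := out _ xD; have [yD1 yD2] := out _ yD.
  by rewrite (negbTE xD1) (negbTE xD2) (negbTE yD1) (negbTE yD2).
pose glue (phi : {ffun {ffun seq_sub s -> bool * bool} -> seq_sub s}) x :=
  if x \in D then act (val (phi (type_of x))) x else x.
apply: (@sub_finite_set _ _ (range glue)); last first.
  exact/finite_image/finite_finset.
move=> f Gf; have [f_out f_in] := GG_support Gf.
have /choice[phi phiE] : forall T, exists k : seq_sub s,
    forall x, D x -> type_of x = T -> f x = act (val k) x.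
  move=> T; have [[x [xD xT]]|nT] := pselect (exists x, D x /\ type_of x = T).
    have [k Gk kE] := GG_piecewise Gf x.
    have ks : k \in s by apply: (stay_in_s k x); rewrite // -kE //; apply: f_in.
    exists (SeqSub ks) => y yD yT; apply: kE; apply: type_sim => //.
    by rewrite xT yT.
  have s1 : (1, 0) \in s by apply/in_s; split; rewrite // normr0 rr addr_ge0.
  by exists (SeqSub s1) => x xD xT; case: nT; exists x.
exists [ffun T => phi T] => //; apply/funext => x; rewrite /glue ffunE.
case: ifPn; rewrite ?in_setE ?notin_setE => xD; first by rewrite -phiE.
by rewrite f_out.
Qed.
End Discrete.

(** * The crystallographic case *)

Section Lattice.
Local Open Scope complex_scope.
Variables (R : realType) (m : nat) (t : int).
Hypothesis m_gt2 : (2 < m)%N.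
Hypothesis cos_int : 2 * cos (2 * pi / m%:R) = t%:~R :> R.
Let zeta : R[i] := root1 R m.
Implicit Types w z : R[i].

Let m_gt0 : (0 < m)%N. Proof. lia. Qed.

Definition lattice : set R[i] :=
  [set p%:~R + q%:~R * zeta | p in setT & q in setT].

Lemma latticeP w : lattice w <-> exists p q : int, w = p%:~R + q%:~R * zeta.
Proof.
by split=> [[p _ [q _ <-]]|[p [q ->]]]; [exists p, q|exists p => //; exists q].
Qed.

Lemma zeta_sqr : zeta ^+ 2 = t%:~R * zeta - 1.
Proof.
have -> : t%:~R = (2 * cos (2 * pi / m%:R) : R)%:C.
  by rewrite cos_int rmorph_int.
rewrite /zeta /root1 /cis; set u := 2 * pi / m%:R.
have s2 : sin u * sin u = 1 - cos u * cos u by rewrite -!expr2 sin2cos2.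
apply/eqP; rewrite expr2 eq_complex /= s2.
by apply/andP; split; apply/eqP; ring.
Qed.

Lemma lattice1 : lattice 1.
Proof. by apply/latticeP; exists 1, 0; rewrite mul0r addr0. Qed.

Lemma latticeB w z : lattice w -> lattice z -> lattice (w - z).
Proof.
move=> /latticeP[p [q ->]] /latticeP[p' [q' ->]]; apply/latticeP.
by exists (p - p'), (q - q'); rewrite !rmorphB /=; ring.
Qed.

Lemma latticeN w : lattice w -> lattice (- w).
Proof.
move=> /latticeP[p [q ->]]; apply/latticeP.
by exists (- p), (- q); rewrite !rmorphN /=; ring.
Qed.

(** zeta^2 = t zeta - 1 with t an integer makes the lattice a ring. *)
Lemma latticeXM i w : lattice w -> lattice (zeta ^+ i * w).
Proof.
move=> Lw; elim: i => [|i /latticeP[p [q e]]]; first by rewrite mul1r.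
apply/latticeP; exists (- q), (p + q * t).
rewrite exprS -mulrA e mulrDr [zeta * (q%:~R * _)]mulrCA -expr2 zeta_sqr.
by rewrite !rmorphD rmorphN rmorphM /=; ring.
Qed.

Definition lattice_isometries : set (R[i] * R[i]) :=
  [set k | (exists i, k.1 = zeta ^+ i) /\ lattice k.2].

(** Inverses as nonnegative powers keep the group described by exponents in
    nat. *)
Lemma zetaXV i : (zeta ^+ i)^-1 = zeta ^+ (m.-1 * i).
Proof.
have oi : zeta ^+ i != 0 by rewrite expf_neq0 ?root1_neq0.
apply: (mulIf oi); rewrite mulVf // -exprD -mulSnr prednK // exprM.
by rewrite root1X // expr1n.
Qed.

Lemma finite_bounded_ints N : finite_set [set p : int | `|p| <= N%:Z].
Proof.
apply: (sub_finite_set (B := (fun j : nat => j%:Z - N%:Z) @` `I_(N + N).+1)).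
  move=> p /= pN; exists (absz (p + N%:Z)); lia.
exact/finite_image/finite_II.
Qed.

Lemma normc_ge_Im z : `|complex.Im z|%:C <= `|z|.
Proof.
rewrite normc_def lecR -sqrtr_sqr ler_sqrt ?lerDr ?sqr_ge0 //.
by rewrite addr_ge0 ?sqr_ge0.
Qed.

Lemma sin_gt0 : 0 < sin (2 * pi / m%:R) :> R.
Proof.
have m0 : 0 < m%:R :> R by rewrite ltr0n.
apply: sin_gt0_pi; rewrite divr_gt0 ?mulr_gt0 ?pi_gt0 //= ltr_pdivrMr //.
by rewrite mulrC ltr_pM2l ?pi_gt0 // ltr_nat.
Qed.

(** The imaginary part q sin(2 pi / m) bounds q, and then p = w - q zeta is
    bounded by |w| + |q|. *)
Lemma lattice_discrete (B : R) : exists N, forall p q : int,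
  `|p%:~R + q%:~R * zeta| <= B%:C -> `|p| <= N%:Z /\ `|q| <= N%:Z.
Proof.
have s0 := sin_gt0; set s := sin _ in s0.
pose M := `|B| + `|B| / s.
have M0 : 0 <= M by rewrite addr_ge0 ?divr_ge0 // ltW.
exists (Num.bound M) => p q pqB.
have MN := archi_boundP M0.
suff [hp hq] : `|p|%:~R <= M /\ `|q|%:~R <= M.
  by split; rewrite -(ler_int R) -pmulrn ltW // (le_lt_trans _ MN).
have hq : `|q%:~R : R| <= `|B| / s.
  rewrite ler_pdivlMr // -[s in _ * s]gtr0_norm // -normrM -lecR.
  have Im_pq : complex.Im (p%:~R + q%:~R * zeta) = q%:~R * s.
    by rewrite -!(rmorph_int (real_complex R)) /zeta /root1 /cis /= -/s; ring.
  rewrite -Im_pq (le_trans (normc_ge_Im _)) // (le_trans pqB) // lecR.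
  exact: ler_norm.
rewrite !intr_norm; split; last first.
  by rewrite (le_trans hq) // lerDr.
have cR (i : int) : `|i%:~R : R[i]| = `|i%:~R : R|%:C.
  by rewrite -(rmorph_int (real_complex R)) normc_def /= expr0n addr0 sqrtr_sqr.
rewrite -lecR -cR -[p%:~R](addrK (q%:~R * zeta)) (le_trans (ler_normB _ _)) //.
rewrite normrM cis_norm mulr1 rmorphD lerD //.
  by rewrite (le_trans pqB) // lecR ler_norm.
by rewrite cR lecR.
Qed.

Lemma lattice_isometries_discrete (B : R) :
  finite_set [set k | lattice_isometries k /\ `|k.2| <= B%:C].
Proof.
have [N NP] := lattice_discrete B.
(* Only the exponent modulo m matters for the linear part. *)
pose F (c : nat * (int * int)) : R[i] * R[i] :=
  (zeta ^+ c.1, c.2.1%:~R + c.2.2%:~R * zeta).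
pose Z := [set p : int | `|p| <= N%:Z].
apply: (sub_finite_set (B := F @` (`I_m `*` (Z `*` Z)))).
  move=> [u w] /= [[[i /= ->] /latticeP[p [q /= ->]]] /NP[pN qN]].
  exists (i %% m, (p, q))%N => /=; first by rewrite ltn_mod.
  by rewrite /F /= {2}(divn_eq i m) exprD mulnC exprM root1X // expr1n mul1r.
apply: finite_image; apply: finite_setX; first exact: finite_II.
by apply: finite_setX; exact: finite_bounded_ints.
Qed.

(** An integral 2 cos(2 pi / m) is the crystallographic restriction: it makes
    the rotations by multiples of 2 pi / m preserve a lattice. *)
Theorem finite_GG_crystallographic n1 n2 (r : R) : 0 < r ->
  (n1 %| m)%N -> (n2 %| m)%N -> finite_set (GG n1 n2 r).
Proof.
move=> r0 d1 d2.
have inv_pow n : (n %| m)%N -> exists i, (root1 R n)^-1 = zeta ^+ i.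
  move=> d; exists (m.-1 * (m %/ n))%N.
  by rewrite (root1_dvd R m_gt0 d) -/zeta zetaXV.
have [[i1 e1] [i2 e2]] := (inv_pow _ d1, inv_pow _ d2).
have LX i : lattice (zeta ^+ i).
  by rewrite -[_ ^+ _]mulr1; apply/latticeXM/lattice1.
apply: (finite_GG r0 (Gamma := lattice_isometries)).
- split=> /=; first by exists 0%N.
  by rewrite -(subrr 1); apply: latticeB; exact: lattice1.
- move=> [_ w] [_ w'] /= [[i /= ->] Lw] [[j /= ->] Lw'].
  split=> /=; first by exists (i + j)%N; rewrite exprD.
  by rewrite -[w]opprK; apply: latticeB; [exact: latticeXM|exact: latticeN].
- move=> [_ w] /= [[i /= ->] Lw]; rewrite zetaXV; split=> /=.
    by exists (m.-1 * i)%N.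
  by apply/latticeN/latticeXM.
- by move=> [_ w] [[i /= ->] _]; rewrite normrX cis_norm expr1n.
- rewrite e1; split; first by exists i1.
  by apply: latticeB; [exact: LX|exact: lattice1].
- rewrite e2; split; first by exists i2.
  by apply: latticeB; [exact: lattice1|exact: LX].
- exact: lattice_isometries_discrete.
Qed.
End Lattice.


(** * The criterion *)

Theorem theorem1 (R : realType) (n1 n2 : nat)
    (n1_gt1 : (1 < n1)%N) (n2_gt1 : (1 < n2)%N) :
  (exists r : R, 0 < r /\ infinite_set (GG n1 n2 r)) <->
  lcmn n1 n2 \notin [:: 2; 3; 4; 6]%N.
Proof.
set n := lcmn n1 n2.
have [d1 d2] : (n1 %| n)%N /\ (n2 %| n)%N by rewrite dvdn_lcml dvdn_lcmr.
have n_gt0 : (0 < n)%N by rewrite lcmn_gt0 (ltnW n1_gt1) (ltnW n2_gt1).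
have n_ge2 : (1 < n)%N := leq_trans n1_gt1 (dvdn_leq n_gt0 d1).
split=> [[r [r0 GG_inf]]|n_nin]; last first.
  apply: infinite_GG => //; move: n_ge2 n_nin; rewrite !inE -/n.
  by clear; move: n => l; lia.
apply/negP => n_in; apply: GG_inf.
have [n4|n6] : (n %| 4)%N \/ (n %| 6)%N.
  by move: n_in; rewrite !inE => /or4P[] /eqP ->; [left|right|left|right].
- apply: (@finite_GG_crystallographic R 4 0) => //.
  + have -> : 2 * pi / 4%:R = pi / 2 :> R by field.
    by rewrite cos_pihalf mulr0.
  + exact: dvdn_trans d1 n4.
  + exact: dvdn_trans d2 n4.
- apply: (@finite_GG_crystallographic R 6 1) => //.
  + have -> : 2 * pi / 6%:R = pi / 3 :> R by field.
    by rewrite cos_pi3 div1r mulfV ?pnatr_eq0.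
  + exact: dvdn_trans d1 n6.
  + exact: dvdn_trans d2 n6.
Qed.
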